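(* For every $n\ge 1$ and every centrally symmetric convex body $K$ in $\mathbb{R}^{2n}$, $$\overline{c}(K)\le 4\,c_{\mathrm{EHZ}}(K),$$ where $\overline{c}$ is the cylindrical capacity and $c_{\mathrm{EHZ}}$ is the Ekeland--Hofer--Zehnder capacity.
   Context: $\mathbb{R}^{2n}$ has coordinates $(q,p)$, the standard symplectic form $\omega=dp\wedge dq$ and the standard inner product $\langle\cdot,\cdot\rangle$; it is identified with $\mathbb{C}^n$ via $z_j=q_j+ip_j$. A convex body is a compact convex set with non-empty interior; it is centrally symmetric if $K=-K$. Cylindrical capacity: let $B^{2}(r)\subset\mathbb{C}$ be the open disc of radius $r$ and $Z^{2n}(r)=B^2(r)\times\mathbb{C}^{n-1}$. For $U\subset\mathbb{R}^{2n}$, $\overline{c}(U)=\inf\{\pi r^2 : U \text{ embeds symplectically into } Z^{2n}(r)\}$. Ekeland--Hofer--Zehnder capacity: for a convex body $K$ with smooth boundary, a closed characteristic on $\partial K$ is an embedded circle in $\partial K$ everywhere tangent to the line bundle $\{(x,\xi)\in T\partial K : \omega(\xi,\eta)=0 \text{ for all } \eta\in T_x\partial K\}$. The action of a closed curve $\gamma$ is $A(\gamma)=\int_\gamma p\,dq$. Then $c_{\mathrm{EHZ}}(K)=\min\{|A(\gamma)| : \gamma \text{ a closed characteristic on } \partial K\}$ (the minimum exists). For an arbitrary convex body, $c_{\mathrm{EHZ}}$ is defined by the (unique) extension that is continuous with respect to the Hausdorff distance. *)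

(* Defs.v *)
From mathcomp Require Import all_boot all_order all_algebra.
From mathcomp Require Import all_classical all_reals all_analysis.
Import Order.TTheory GRing.Theory Num.Theory.
Import numFieldNormedType.Exports.

Set Implicit Arguments.
Unset Strict Implicit.
Unset Printing Implicit Defensive.

Local Open Scope classical_set_scope.
Local Open Scope ring_scope.

Fixpoint iter_derive (R : realType) (V W : normedModType R) (vs : seq V)
    (f : V -> W) : V -> W :=
  if vs is v :: vs' then 'D_v (iter_derive vs' f) else f.

(* C^infinity on an open set [U]: all iterated directional derivatives exist
   and are (Frechet-)differentiable, hence continuous, at every point of [U]. *)
Definition smooth_on (R : realType) (V W : normedModType R) (U : set V)
    (f : V -> W) : Prop :=
  forall (vs : seq V) (x : V), U x -> differentiable (iter_derive vs f) x.

(* R^{2n} is ['rV[R]_(n + n)]: a vector is the row (q, p). *)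
Definition qcoord (R : realType) (n : nat) (x : 'rV[R]_(n + n)) (i : 'I_n) : R :=
  x ord0 (lshift n i).

Definition pcoord (R : realType) (n : nat) (x : 'rV[R]_(n + n)) (i : 'I_n) : R :=
  x ord0 (rshift n i).

Definition omega (R : realType) (n : nat) (x y : 'rV[R]_(n + n)) : R :=
  \sum_(i < n) (pcoord x i * qcoord y i - qcoord x i * pcoord y i).

(* The library norm on ['rV[R]_m] is the max norm; it induces the same topology
   and the same notions of differentiability. *)
Definition enorm (R : realType) (m : nat) (x : 'rV[R]_m) : R :=
  Num.sqrt (\sum_(i < m) x ord0 i ^+ 2).

Definition edist_set (R : realType) (m : nat) (x : 'rV[R]_m)
    (A : set 'rV[R]_m) : R :=
  inf [set enorm (x - a) | a in A].

Definition hausdorff_dist (R : realType) (m : nat) (A B : set 'rV[R]_m) : R :=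
  Num.max (sup [set edist_set a B | a in A]) (sup [set edist_set b A | b in B]).

Definition convex_body (R : realType) (m : nat) (K : set 'rV[R]_m) : Prop :=
  [/\ compact K, convex_set K & K° !=set0].

Definition centrally_symmetric (R : realType) (m : nat)
    (K : set 'rV[R]_m) : Prop :=
  K = -%R @` K.

Definition symplectic_on (R : realType) (n : nat) (V : set 'rV[R]_(n + n))
    (phi : 'rV[R]_(n + n) -> 'rV[R]_(n + n)) : Prop :=
  forall x, V x -> forall xi eta, omega ('d phi x xi) ('d phi x eta) = omega xi eta.

(* A symplectic embedding of a set that need not be open is the restriction of
   a symplectic embedding (smooth, symplectic, homeomorphism onto its image) of
   an open neighbourhood of it. *)
Definition embeds_symplectically (R : realType) (n : nat)
    (U Z : set 'rV[R]_(n + n)) : Prop :=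
  exists (V : set 'rV[R]_(n + n)) (phi psi : 'rV[R]_(n + n) -> 'rV[R]_(n + n)),
    [/\ open V /\ U `<=` V,
        smooth_on V phi /\ symplectic_on V phi,
        (forall x, V x -> psi (phi x) = x),
        {within phi @` V, continuous psi}
      & phi @` U `<=` Z].

(* B^2(r) x C^{n-1}; the disc is in the first complex coordinate q_0 + i p_0. *)
Definition cylinder (R : realType) (n : nat) (r : R) : set 'rV[R]_(n + n) :=
  [set x | forall i : 'I_n, i = 0%N :> nat ->
     qcoord x i ^+ 2 + pcoord x i ^+ 2 < r ^+ 2].

Definition cyl_capacity (R : realType) (n : nat)
    (U : set 'rV[R]_(n + n)) : \bar R :=
  ereal_inf [set (pi * r ^+ 2)%:E | r in
    [set r : R | 0 < r /\ embeds_symplectically U (cylinder (n := n) r)]].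

Definition bdry (R : realType) (m : nat) (K : set 'rV[R]_m) : set 'rV[R]_m :=
  closure K `\` K°.

Definition defining_function_at (R : realType) (m : nat) (K : set 'rV[R]_m)
    (x : 'rV[R]_m) (U : set 'rV[R]_m) (F : 'rV[R]_m -> R) : Prop :=
  [/\ open U /\ U x,
      smooth_on U F,
      (forall y, U y -> exists v, 'd F y v != 0)
    & bdry K `&` U = [set y | F y = 0] `&` U].

Definition smooth_boundary (R : realType) (m : nat) (K : set 'rV[R]_m) : Prop :=
  forall x, bdry K x -> exists U F, defining_function_at K x U F.

(* T_x(bdry K), as the kernel of the differential of a local defining function
   (it does not depend on the latter). *)
Definition tangent_space (R : realType) (m : nat) (K : set 'rV[R]_m)
    (x : 'rV[R]_m) : set 'rV[R]_m :=
  [set xi | exists U F, defining_function_at K x U F /\ 'd F x xi = 0].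

Definition characteristic_line (R : realType) (n : nat)
    (K : set 'rV[R]_(n + n)) (x : 'rV[R]_(n + n)) : set 'rV[R]_(n + n) :=
  [set xi | tangent_space K x xi /\
     forall eta, tangent_space K x eta -> omega xi eta = 0].

(* A closed characteristic, given by a regular 1-periodic parametrization, i.e.
   by a smooth embedding of the circle R / Z. *)
Definition closed_characteristic (R : realType) (n : nat)
    (K : set 'rV[R]_(n + n)) (gamma : R -> 'rV[R]_(n + n)) : Prop :=
  [/\ smooth_on setT gamma,
      (forall t, gamma (t + 1) = gamma t),
      {in `[0, 1[ &, injective gamma},
      (forall t, derive1 gamma t != 0)
    & forall t, bdry K (gamma t) /\ characteristic_line K (gamma t) (derive1 gamma t)].

(* The integral of p dq along [gamma] over one period. *)
Definition action (R : realType) (n : nat) (gamma : R -> 'rV[R]_(n + n)) : R :=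
  \int[lebesgue_measure]_(t in `[0, 1])
    \sum_(i < n) pcoord (gamma t) i * qcoord (derive1 gamma t) i.

(* [c] is the Ekeland-Hofer-Zehnder capacity on convex bodies: the least action
   of a closed characteristic when the boundary is smooth, extended
   continuously for the Hausdorff distance. This determines [c] on convex bodies
   since those with smooth boundary are dense. *)
Definition is_ehz_capacity (R : realType) (n : nat)
    (c : set 'rV[R]_(n + n) -> R) : Prop :=
  (forall K, convex_body K -> smooth_boundary K ->
     let actions := [set `|action gamma| | gamma in closed_characteristic K] in
     actions (c K) /\ lbound actions (c K)) /\
  (forall K, convex_body K -> forall e, 0 < e -> exists2 d, 0 < d &
     forall L, convex_body L -> hausdorff_dist K L < d -> `|c K - c L| < e).

(* Main.v *)
Require Import Defs.
From HB Require Import structures.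
From mathcomp Require Import all_boot all_order all_algebra.
From mathcomp Require Import all_classical all_reals all_analysis.
From mathcomp Require Import ring lra.
Import Order.TTheory GRing.Theory Num.Theory.
Import numFieldNormedType.Exports.

Set Implicit Arguments.
Unset Strict Implicit.
Unset Printing Implicit Defensive.

Local Open Scope classical_set_scope.
Local Open Scope ring_scope.

(* Let K^w be the set of all u with omega(u, z) <= 1 for every z in K.
   Upper bound: if u, v in K^w and omega(u, v) = s > 0, symplectic linear maps
   act transitively on pairs with omega = 1, so the functionals
   omega(u, .) / sqrt s and - omega(v, .) / sqrt s become q_0, p_0 after a linear
   symplectic map; by central symmetry they are at most 1 / sqrt s on K, so K
   lands in a cylinder of squared radius 2 / s, and the capacity of K is at most
   2 pi / s.
   Lower bound: on a smooth L containing K, a closed characteristic g satisfies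
   g' / omega(g', g) in L^w, a subset of K^w. If omega <= s on K^w, measuring g by
   the length |omega(g', g)| dt, of total 2 |A|, gives
   |omega(g'(t), g(t) - g(0))| <= s |omega(g'(t), g(t))| l(t), where l(t) is the
   length of the shorter arc from g(0) to g(t). Integrating over the loop,
   2 |A| <= s |A|^2, that is |A| >= 2 / s.
   Such L near K are sublevel sets of sums of high even powers of finitely many
   functionals from K^w. With s the supremum of omega on K^w, c(K) >= 2 / s and the
   capacity of K is at most 2 pi / s <= pi c(K) <= 4 c(K). *)

(** * Linear algebra of [omega]: transvections and transitivity on pairs *)

Section OmegaForm.
Variables (R : realType) (n : nat).
Implicit Types (x y z u v : 'rV[R]_(n + n)) (c : R).

Lemma omegaDl x y z : omega (x + y) z = omega x z + omega y z.
Proof.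
rewrite /omega -big_split; apply: eq_bigr => i _ /=.
by rewrite /pcoord /qcoord !mxE; ring.
Qed.

Lemma omegaC x y : omega x y = - omega y x.
Proof.
rewrite /omega -sumrN; apply: eq_bigr => i _.
by rewrite /pcoord /qcoord; ring.
Qed.

Lemma omegaZl c x y : omega (c *: x) y = c * omega x y.
Proof.
rewrite /omega big_distrr; apply: eq_bigr => i _ /=.
by rewrite /pcoord /qcoord !mxE; ring.
Qed.

Lemma omegaNl x y : omega (- x) y = - omega x y.
Proof. by rewrite -scaleN1r omegaZl mulN1r. Qed.

Lemma omegaBl x y z : omega (x - y) z = omega x z - omega y z.
Proof. by rewrite omegaDl omegaNl. Qed.

Lemma omegaDr x y z : omega x (y + z) = omega x y + omega x z.
Proof. by rewrite omegaC omegaDl opprD -!omegaC. Qed.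

Lemma omegaZr c x y : omega x (c *: y) = c * omega x y.
Proof. by rewrite omegaC omegaZl -mulrN -omegaC. Qed.

Lemma omegaNr x y : omega x (- y) = - omega x y.
Proof. by rewrite omegaC omegaNl -omegaC. Qed.

Lemma omegaBr x y z : omega x (y - z) = omega x y - omega x z.
Proof. by rewrite omegaDr omegaNr. Qed.

Lemma omega_xx x : omega x x = 0.
Proof. by apply: big1 => i _; rewrite mulrC subrr. Qed.

Lemma omega0l x : omega 0 x = 0.
Proof. by rewrite -(subrr x) omegaBl subrr. Qed.

Definition omegaE := (omegaDl, omegaBl, omegaNl, omegaZl, omegaDr, omegaBr,
  omegaNr, omegaZr, omega_xx, omega0l).

Definition edot x y : R := \sum_i x ord0 i * y ord0 i.

(** Multiplication by i under z = q + i p. *)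
Definition jmul x : 'rV[R]_(n + n) :=
  row_mx (- rsubmx x) (lsubmx x).

Lemma omega_jmul x y : omega (jmul x) y = edot x y.
Proof.
rewrite /edot big_split_ord /= /omega -big_split; apply: eq_bigr => i _ /=.
by rewrite /pcoord /qcoord /jmul row_mxEr row_mxEl !mxE; ring.
Qed.

(** Pairing x with [jmul x] gives minus the sum of the squares of the coordinates of x. *)
Lemma omega_nondegenerate x : (forall y, omega x y = 0) -> x = 0.
Proof.
move=> x0; apply/rowP => k; rewrite [RHS]mxE.
have /eqP := x0 (jmul x); rewrite omegaC omega_jmul oppr_eq0 /edot.
rewrite psumr_eq0; last by move=> i _; rewrite -expr2 sqr_ge0.
by move=> /allP /(_ k (mem_index_enum _)) /=; rewrite -expr2 sqrf_eq0 => /eqP.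
Qed.

Lemma omega_continuous u : continuous (omega u).
Proof.
rewrite /omega; apply: continuous_big => [|i _]; first exact: add_continuous.
move=> x; apply: (@continuousB _ _ _ (fun x => pcoord u i * qcoord x i)
  (fun x => qcoord u i * pcoord x i)); apply: continuousM;
  [exact: cst_continuous|exact: coord_continuous
  |exact: cst_continuous|exact: coord_continuous].
Qed.

Definition transvection c a x := x + (c * omega x a) *: a.

(* [h] being continuous makes [g] a symplectic embedding in the sense of
   [embeds_symplectically]. *)
Definition linear_symplectic (g : 'rV[R]_(n + n) -> 'rV[R]_(n + n)) :=
  [/\ linear g, continuous g, forall x y, omega (g x) (g y) = omega x y
    & exists2 h, continuous h & cancel g h].

(** Antisymmetry cancels the two cross terms and omega a a = 0 kills the quadratic one. Since omega
    (x + t a) a = omega x a, the inverse is the transvection with coefficient - c. *)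
Lemma transvection_symplectic c a : linear_symplectic (transvection c a).
Proof.
have cont d : continuous (transvection d a).
  have -> : transvection d a = (fun x => x + (- d * omega a x) *: a).
    by apply/funext => x; rewrite /transvection omegaC mulrN mulNr.
  move=> x; apply: (@continuousD _ _ _ id (fun x => (- d * omega a x) *: a)).
    exact: cvg_id.
  apply: (@continuousZ _ _ _ (fun x => - d * omega a x) (cst a)).
    by apply: continuousM; [exact: cst_continuous|exact: omega_continuous].
  exact: cst_continuous.
split=> [d x y||x y|]; first 1 last.
- exact: cont.
- by rewrite /transvection !omegaE (omegaC a y); ring.
- exists (transvection (- c) a) => [|x]; first exact: cont.
  by rewrite /transvection !omegaE mulr0 addr0 mulNr scaleNr addrK.
- rewrite /transvection !omegaE mulrDr scalerDl scalerDr !scalerA addrACA.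
  by congr (_ + _ *: _ + _); rewrite mulrCA.
Qed.

Lemma linear_symplectic_comp g1 g2 : linear_symplectic g1 ->
  linear_symplectic g2 -> linear_symplectic (g1 \o g2).
Proof.
move=> [l1 c1 o1 [h1 ch1 k1]] [l2 c2 o2 [h2 ch2 k2]]; split.
- by move=> d x y /=; rewrite l2 l1.
- by move=> x; apply: continuous_comp; [exact: c2|exact: c1].
- by move=> x y /=; rewrite o1 o2.
- exists (h2 \o h1); last exact: can_comp.
  by move=> x; apply: continuous_comp; [exact: ch1|exact: ch2].
Qed.

(** As omega x (y - x) = omega x y, the coefficient 1 / omega x y adds exactly y - x to x. *)
Lemma transvection_move x y : omega x y != 0 ->
  exists2 c, transvection c (y - x) x = y &
    forall z, omega z (y - x) = 0 -> transvection c (y - x) z = z.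
Proof.
move=> xy; exists (omega x y)^-1 => [|z z0].
  by rewrite /transvection !omegaE subr0 mulVf // scale1r addrC subrK.
by rewrite /transvection z0 mulr0 scale0r addr0.
Qed.

(** If omega v v' is nonzero, one transvection along v' - v works, and it fixes u because omega u
    (v' - v) = 0. Otherwise go through w = v + u, which pairs to 1 with u and is orthogonal to
    neither v nor v'. *)
Lemma symplectic_fix_move u v v' : omega u v = 1 -> omega u v' = 1 ->
  exists g, [/\ linear_symplectic g, g u = u & g v = v'].
Proof.
move=> uv uv'; have [|vv'] := eqVneq (omega v v') 0; last first.
  have [c cv fix_] := transvection_move vv'.
  exists (transvection c (v' - v)); split=> //; first exact: transvection_symplectic.
  by apply: fix_; rewrite !omegaE uv uv' subrr.
move=> vv'0; pose w := v + u.
have uw : omega u w = 1 by rewrite /w !omegaE uv addr0.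
have vw : omega v w != 0 by rewrite /w !omegaE add0r omegaC uv oppr_eq0 oner_neq0.
have wv' : omega w v' != 0 by rewrite /w !omegaE uv' vv'0 add0r oner_neq0.
have [c cv fixc] := transvection_move vw.
have [d dw fixd] := transvection_move wv'.
exists (transvection d (v' - w) \o transvection c (w - v)); split.
- by apply: linear_symplectic_comp; exact: transvection_symplectic.
- by rewrite /= fixc ?fixd // omegaBr uw ?uv ?uv' subrr.
- by rewrite /= cv.
Qed.

(** Two transvections suffice once some w is orthogonal to neither u nor u'; one of v, v', v + v'
    always is such a w. *)
Lemma symplectic_move1 u v u' v' : omega u v = 1 -> omega u' v' = 1 ->
  exists2 g, linear_symplectic g & g u = u'.
Proof.
move=> uv uv'.
have step x y w : omega x w != 0 -> omega w y != 0 ->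
    exists2 g, linear_symplectic g & g x = y.
  move=> /transvection_move[c cx _] /transvection_move[d dw _].
  exists (transvection d (y - w) \o transvection c (w - x)); last by rewrite /= cx.
  by apply: linear_symplectic_comp; exact: transvection_symplectic.
have [u'v|u'v] := eqVneq (omega u' v) 0; last first.
  by apply: (step _ _ v); rewrite ?uv ?oner_neq0 // omegaC oppr_eq0.
have [uv'0|uv'0] := eqVneq (omega u v') 0; last first.
  by apply: (step _ _ v') => //; rewrite omegaC uv' oppr_eq0 oner_neq0.
apply: (step _ _ (v + v')); first by rewrite !omegaE uv uv'0 addr0 oner_neq0.
by rewrite omegaC !omegaE u'v uv' add0r oppr_eq0 oner_neq0.
Qed.

Lemma symplectic_transitive u v u' v' : omega u v = 1 -> omega u' v' = 1 ->
  exists g, [/\ linear_symplectic g, g u = u' & g v = v'].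
Proof.
move=> uv uv'; have [g gs gu] := symplectic_move1 uv uv'.
have [_ _ go _] := gs.
have [k [ks ku kv]] := @symplectic_fix_move u' (g v) v'
  ltac:(by rewrite -gu go) uv'.
exists (k \o g); split; first exact: linear_symplectic_comp.
- by rewrite /= gu.
- by rewrite /= kv.
Qed.

Lemma linear_symplectic_smooth g : linear_symplectic g ->
  smooth_on setT g /\ symplectic_on setT g.
Proof.
move=> [gl gc go _].
pose glM := GRing.isLinear.Build _ _ _ _ _ gl.
pose gL : {linear _ -> _} := HB.pack g glM.
have dg x : 'd g x = g :> (_ -> _) by exact: (@diff_lin _ _ _ gL).
have difg x : differentiable g x by exact: (@linear_differentiable _ _ _ gL).
split; last by move=> x _ xi eta; rewrite !dg go.
move=> vs x _.
(* The first directional derivative of a linear map is constant, and all later ones vanish. *)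
have [->//|[w ->]] : iter_derive vs g = g \/
    exists w, iter_derive vs g = cst w.
  elim: vs => [|v vs IH] /=; [by left|right].
  case: IH => [->|[w ->]].
    by exists (g v); apply/funext => y; rewrite deriveE // dg.
  by exists 0; apply/funext => y; rewrite derive_cst.
exact: differentiable_cst.
Qed.

Lemma linear_symplectic_embeds g (U Z : set 'rV[R]_(n + n)) :
  linear_symplectic g -> (forall x, U x -> Z (g x)) -> embeds_symplectically U Z.
Proof.
move=> gs UZ; have [g1 g2] := linear_symplectic_smooth gs.
have [_ _ _ [h ch gh]] := gs.
exists setT, g, h; split=> //; first by split=> //; exact: openT.
- exact: continuous_subspaceT.
- by move=> _ [x Ux <-]; exact: UZ.
Qed.

End OmegaForm.

(** * Upper bound: linear embeddings into cylinders *)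

Section CylinderBound.
Variables (R : realType) (n : nat).
Implicit Types (K : set 'rV[R]_(n + n)) (x u v : 'rV[R]_(n + n)).

(** The image of the Euclidean polar of K under [jmul]. *)
Definition omega_polar K : set 'rV[R]_(n + n) :=
  [set u | forall z, K z -> omega u z <= 1].

Definition pvec (i : 'I_n) : 'rV[R]_(n + n) := delta_mx ord0 (rshift n i).
Definition qvec (i : 'I_n) : 'rV[R]_(n + n) := delta_mx ord0 (lshift n i).

Lemma omega_pvec i x : omega (pvec i) x = qcoord x i.
Proof.
rewrite /omega (bigD1 i) //= big1 => [|j ji]; rewrite /pcoord /qcoord !mxE /=.
  by rewrite !eqxx eq_lrshift mul1r mul0r subr0 addr0.
by rewrite eq_rshift (negbTE ji) eq_lrshift !mul0r subr0.
Qed.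

Lemma omega_qvec i x : omega (qvec i) x = - pcoord x i.
Proof.
rewrite /omega (bigD1 i) //= big1 => [|j ji]; rewrite /pcoord /qcoord !mxE /=.
  by rewrite !eqxx eq_rlshift mul1r mul0r sub0r addr0.
by rewrite eq_lshift (negbTE ji) eq_rlshift !mul0r subr0.
Qed.

Lemma omega_pvec_qvec i : omega (pvec i) (qvec i) = 1.
Proof. by rewrite omega_pvec /qcoord mxE !eqxx. Qed.

Lemma cyl_capacity_le K u v s : (0 < n)%N -> centrally_symmetric K ->
  omega_polar K u -> omega_polar K v -> 0 < s -> omega u v = s ->
  (cyl_capacity K <= (2 * pi / s)%:E)%E.
Proof.
move=> n0 Ksym Ku Kv s0 uv; pose i0 := Ordinal n0.
pose d := (Num.sqrt s)^-1.
have d2 : d ^+ 2 = s^-1 by rewrite exprVn sqr_sqrtr // ltW.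
have duv : omega (d *: u) (d *: v) = 1.
  by rewrite !omegaE uv mulrA -expr2 d2 mulVf // gt_eqF.
have [g [gs gu gv]] := symplectic_transitive duv (omega_pvec_qvec i0).
have [_ _ go _] := gs.
have bound w : omega_polar K w -> forall z, K z -> omega w z ^+ 2 <= 1.
  move=> Kw z Kz; have w1 := Kw _ Kz; have : omega w (- z) <= 1.
    by apply: Kw; move: Kz; rewrite Ksym => -[y Ky <-]; rewrite opprK -Ksym.
  by rewrite omegaNr; nra.
have pi0 : 0 < pi :> R by exact: pi_gt0.
(* The disc is open while the bound 2 / s may be attained on K, so the squared radius is enlarged by
   e / pi, which costs an area e. *)
apply/lee_addgt0Pr => e e0; apply: ereal_inf_lbound.
have r0 : 0 < 2 / s + e / pi by rewrite addr_gt0 // divr_gt0.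
exists (Num.sqrt (2 / s + e / pi)); last first.
  rewrite sqr_sqrtr ?ltW // -EFinD; congr (_%:E).
  by move: (pi : R) pi0 => p p0; field; rewrite !gt_eqF.
split; first by rewrite sqrtr_gt0.
apply: linear_symplectic_embeds gs _ => x Kx i i0E.
have -> : i = i0 by apply: val_inj.
have -> : pcoord (g x) i0 = - omega (qvec i0) (g x) by rewrite omega_qvec opprK.
rewrite sqr_sqrtr ?ltW // -omega_pvec sqrrN -gu -gv !go !omegaZl !exprMn d2.
apply: (@le_lt_trans _ _ (2 / s)); last by rewrite ltrDl divr_gt0.
have := bound _ Ku _ Kx; have := bound _ Kv _ Kx => bv bu.
rewrite -mulrDr [leRHS]mulrC ler_pM2l ?invr_gt0 //.
lra.
Qed.

End CylinderBound.

(** * Smoothness of polynomial functions *)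

Lemma is_derive_entry (R : realFieldType) (V : normedModType R) (m n : nat)
    (M : V -> 'M[R]_(m, n)) t v dM i j :
  is_derive t v M dM -> is_derive t v (fun t => M t i j) (dM i j).
Proof.
move=> [dM1 <-]; rewrite derive_mx // mxE; apply: DeriveDef => //.
by have /derivable_mxP := dM1; exact.
Qed.

Section PolynomialFunctions.
Variables (R : realType) (m : nat).
Implicit Types f g : 'rV[R]_m -> R.

(** A class of differentiable functions closed under directional derivatives, so that [smooth_on]
    follows by induction on the list of directions. *)
Inductive polynomial_function : ('rV[R]_m -> R) -> Prop :=
| polyfun_cst c : polynomial_function (cst c)
| polyfun_coord i : polynomial_function (fun x => x ord0 i)
| polyfun_add f g of polynomial_function f & polynomial_function g :
    polynomial_function (f + g)
| polyfun_mul f g of polynomial_function f & polynomial_function g :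
    polynomial_function (f * g).

Lemma polyfun_differentiable f x : polynomial_function f -> differentiable f x.
Proof.
elim=> {f} [c|i|f g _ fd _ gd|f g _ fd _ gd].
- exact: differentiable_cst.
- exact: differentiable_coord.
- exact: differentiableD.
- exact: differentiableM.
Qed.

Lemma polyfun_derive f v : polynomial_function f -> polynomial_function ('D_v f).
Proof.
elim=> {f} [c|i|f g pf fd pg gd|f g pf fd pg gd].
- rewrite (_ : 'D_v _ = cst 0); first exact: polyfun_cst.
  by apply/funext => x; rewrite derive_cst.
- rewrite (_ : 'D_v _ = cst (v ord0 i)); first exact: polyfun_cst.
  apply/funext => x; have := is_derive_entry ord0 i (is_derive_id x v).
  by move=> h; exact: derive_val.
- rewrite (_ : 'D_v _ = 'D_v f + 'D_v g); first exact: polyfun_add.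
  by apply/funext => x; rewrite deriveD //; apply: diff_derivable;
    exact: polyfun_differentiable.
- rewrite (_ : 'D_v _ = f * 'D_v g + g * 'D_v f).
    by apply: polyfun_add; apply: polyfun_mul.
  by apply/funext => x; rewrite deriveM //; apply: diff_derivable;
    exact: polyfun_differentiable.
Qed.

Lemma polyfun_smooth f (U : set 'rV[R]_m) : polynomial_function f -> smooth_on U f.
Proof.
move=> pf vs x _; apply: polyfun_differentiable.
by elim: vs => //= v vs; exact: polyfun_derive.
Qed.

Lemma polyfun_continuous f : polynomial_function f -> continuous f.
Proof.
by move=> pf x; apply: differentiable_continuous; exact: polyfun_differentiable.
Qed.

Lemma polyfun_exp f k : polynomial_function f ->
  polynomial_function (fun x => f x ^+ k).
Proof.
move=> pf; elim: k => [|k IH]; first exact: polyfun_cst.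
rewrite (_ : (fun x => _) = f * (fun x => f x ^+ k)); first exact: polyfun_mul.
by apply/funext => x; rewrite exprS.
Qed.

Lemma polyfun_sum (I : Type) (r : seq I) (F : I -> 'rV[R]_m -> R) :
  (forall i, polynomial_function (F i)) ->
  polynomial_function (fun x => \sum_(i <- r) F i x).
Proof.
move=> pF; elim: r => [|i r IH].
  rewrite (_ : (fun x => _) = cst 0); first exact: polyfun_cst.
  by apply/funext => x; rewrite big_nil.
rewrite (_ : (fun x => _) = F i + (fun x => \sum_(i <- r) F i x)).
  exact: polyfun_add.
by apply/funext => x; rewrite big_cons.
Qed.

Lemma polyfun_scale f c : polynomial_function f ->
  polynomial_function (fun x => c * f x).
Proof. by move=> pf; apply: (polyfun_mul (polyfun_cst c)). Qed.

End PolynomialFunctions.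

(** * Smooth convex bodies as sublevel sets of sums of even powers *)

Section EnergyBody.
Variables (R : realType) (n : nat).
Implicit Types (K : set 'rV[R]_(n + n)) (x y z u v : 'rV[R]_(n + n)).
Implicit Types (us : seq 'rV[R]_(n + n)).

Lemma polyfun_omega u : polynomial_function (omega u).
Proof.
apply: polyfun_sum => i.
rewrite (_ : (fun x => _) = (fun x => pcoord u i * x ord0 (lshift n i)) +
  (fun x => - qcoord u i * x ord0 (rshift n i))).
  by apply: polyfun_add; apply: polyfun_scale; exact: polyfun_coord.
by apply/funext => x; rewrite -mulNr.
Qed.

Lemma is_derive_omega u x v : is_derive x v (omega u) (omega u v).
Proof.
have lo : linear (omega u) by move=> c y z; rewrite omegaDr omegaZr.
pose olM := GRing.isLinear.Build _ _ _ _ _ lo.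
pose oL : {linear _ -> _} := HB.pack (omega u) olM.
have oc := polyfun_continuous (polyfun_omega u).
have od : differentiable (omega u) x by exact/polyfun_differentiable/polyfun_omega.
apply: DeriveDef; first exact: diff_derivable.
by rewrite deriveE // (@diff_lin _ _ _ oL).
Qed.

Definition energy us k x : R := \sum_(u <- us) omega u x ^+ k.

Definition denergy us k x v : R :=
  \sum_(u <- us) k%:R * omega u x ^+ k.-1 * omega u v.

Lemma polyfun_energy us k : polynomial_function (energy us k).
Proof. by apply: polyfun_sum => u; apply: polyfun_exp; exact: polyfun_omega. Qed.

Lemma diff_energy us k x v : (0 < k)%N ->
  'd (energy us k) x v = denergy us k x v.
Proof.
case: k => // k _.
rewrite -deriveE; last exact/polyfun_differentiable/polyfun_energy.
suff h : is_derive x v (energy us k.+1) (denergy us k.+1 x v) by exact: derive_val.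
rewrite /energy /denergy; elim: us => [|u us IH].
  rewrite big_nil (_ : (fun x => _) = cst 0); first exact: is_derive_cst.
  by apply/funext => y; rewrite big_nil.
rewrite big_cons (_ : (fun x => _) =
  omega u ^+ k.+1 + (fun x => \sum_(u <- us) omega u x ^+ k.+1)).
  apply: is_deriveD.
  exact: is_deriveX (is_derive_omega u x v).
by apply/funext => y; rewrite big_cons fctE.
Qed.

Lemma diff_energy_shift us k C x v : (0 < k)%N ->
  'd (fun y => energy us k y - C) x v = denergy us k x v.
Proof.
move=> k0; have pE := polyfun_energy us k.
have dE : differentiable (energy us k) x by exact: polyfun_differentiable.
rewrite (_ : (fun y => _) = energy us k - cst C) // diffB //.
by rewrite diff_cst -diff_energy //= subr0.
Qed.

(** Exponents that are powers of two allow an induction by squaring: with A = a^(2^j) and B =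
    b^(2^j), B^2 >= A^2 + 2 A (B - A), and the induction hypothesis bounds B - A from below. This
    uses A >= 0, which may fail for j = 0, hence the separate case. *)
Lemma expr2n_tangent (a b : R) j :
  a ^+ (2 ^ j) + (2 ^ j)%:R * a ^+ (2 ^ j).-1 * (b - a) <= b ^+ (2 ^ j).
Proof.
elim: j => [|j IH]; first by rewrite expn0 /= !expr1 expr0 !mul1r addrC subrK.
have aj : (0 < j)%N -> 0 <= a ^+ (2 ^ j).
  by move=> j0; apply: exprn_even_ge0; rewrite oddX orbF -lt0n.
have m0 : (0 < 2 ^ j)%N by rewrite expn_gt0.
have -> : (2 ^ j.+1).-1 = (2 ^ j + (2 ^ j).-1)%N.
  by rewrite expnS mul2n -addnn; case: (2 ^ j)%N m0 => // k _; rewrite addnS.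
rewrite expnS mul2n -addnn !exprD natrD.
case: j => [|j] in IH aj m0 *; first rewrite expn0 /= !expr1 expr0.
  by have := sqr_ge0 (b - a); nra.
have := aj isT; move: IH; set A := a ^+ (2 ^ _); set B := b ^+ _.
set M := _%:R; set P := a ^+ _ => IH A0.
have := ler_wpM2l A0 IH => IH2.
have := sqr_ge0 (B - A); nra.
Qed.

Lemma energy_tangent us j x z :
  energy us (2 ^ j) x + denergy us (2 ^ j) x (z - x) <= energy us (2 ^ j) z.
Proof.
rewrite /energy /denergy -big_split ler_sum // => u _ /=.
by rewrite omegaBr expr2n_tangent.
Qed.

Lemma energyZ us k c x : energy us k (c *: x) = c ^+ k * energy us k x.
Proof.
by rewrite /energy big_distrr; apply: eq_bigr => u _; rewrite omegaZr exprMn.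
Qed.

Lemma denergyD us k x y z :
  denergy us k x (y + z) = denergy us k x y + denergy us k x z.
Proof.
by rewrite /denergy -big_split; apply: eq_bigr => u _; rewrite omegaDr mulrDr.
Qed.

Lemma denergyZ us k x c z : denergy us k x (c *: z) = c * denergy us k x z.
Proof.
by rewrite /denergy big_distrr; apply: eq_bigr => u _; rewrite omegaZr mulrCA.
Qed.

Lemma denergyB us k x y z :
  denergy us k x (y - z) = denergy us k x y - denergy us k x z.
Proof. by rewrite denergyD -scaleN1r denergyZ mulN1r. Qed.

Lemma denergy_xx us k x : (0 < k)%N -> denergy us k x x = k%:R * energy us k x.
Proof.
move=> k0; rewrite /denergy /energy big_distrr; apply: eq_bigr => u _ /=.
by rewrite -mulrA -exprSr prednK.
Qed.

Definition energy_body us j (C : R) : set 'rV[R]_(n + n) :=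
  [set x | energy us (2 ^ j) x <= C].

Lemma energy_body_closed us j C : closed (energy_body us j C).
Proof.
apply: (@closed_comp _ _ (energy us (2 ^ j)) [set y | y <= C]) => [x _|].
  by apply: polyfun_continuous; exact: polyfun_energy.
exact: closed_le.
Qed.

(** In the tangent inequalities at w = a x + (1 - a) y, taken at x with weight a and at y with
    weight 1 - a, the linear terms cancel. *)
Lemma energy_body_convex us j C : convex_set (energy_body us j C).
Proof.
move=> x y t; rewrite !inE /energy_body /= => xC yC.
have [a0 a1] : 0 <= t%:num /\ t%:num <= 1 by split; [exact: ge0|exact: le1].
set a := t%:num in a0 a1.
set w := conv t x y; have wE : w = a *: x + (1 - a) *: y by [].
have tx := energy_tangent us j w x; have ty := energy_tangent us j w y.
have xw : x - w = (1 - a) *: (x - y).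
  by rewrite wE; apply/rowP => i; rewrite !mxE; ring.
have yw : y - w = - a *: (x - y).
  by rewrite wE; apply/rowP => i; rewrite !mxE; ring.
rewrite xw denergyZ in tx; rewrite yw denergyZ in ty.
by move: (denergy _ _ _ _) tx ty => D; nra.
Qed.

Section Positive.
Variables (us : seq 'rV[R]_(n + n)) (j : nat) (C : R).
Hypothesis C0 : 0 < C.
Let E := energy us (2 ^ j).
Let L := energy_body us j C.

Let exp_gt0 : (0 < 2 ^ j)%N. Proof. by rewrite expn_gt0. Qed.
Let E_cont : continuous E.
Proof. exact: polyfun_continuous (polyfun_energy _ _). Qed.

(** By continuity E < C holds only at interior points. By homogeneity (1 + d) x leaves the body for
    every d > 0 when E x = C > 0. *)
Lemma bdry_energy_body x : bdry L x <-> E x = C.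
Proof.
have clL : closure L = L by apply/esym/closure_id; exact: energy_body_closed.
rewrite /bdry clL; split=> [[Lx nLx]|ExC].
  apply/eqP; rewrite eq_le; apply/andP; split; first exact: Lx.
  rewrite leNgt; apply/negP => ExC; apply: nLx.
  have : open (E @^-1` [set y | y < C]).
    by apply: open_comp => [y _|]; [exact: E_cont|exact: open_lt].
  move=> oE; apply: (@interiorS _ (E @^-1` [set y | y < C])).
    by move=> y /= /ltW.
  by have /interior_id -> := oE.
split; first by rewrite /L /energy_body /= -/E ExC.
move=> Lx.
have cvg1 : (fun d : R => (1 + d) *: x) @ 0^'+ --> x.
  rewrite -[X in _ --> X](_ : (1 + 0) *: x = x); last by rewrite addr0 scale1r.
  apply: cvg_at_right_filter; apply: cvgZr_tmp.
  by apply: cvgD; [exact: cvg_cst|exact: cvg_id].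
have : \forall d \near (0 : R)^'+, L ((1 + d) *: x) by exact: cvg1 Lx.
have d0 : \forall d \near (0 : R)^'+, 0 < d by exact: nbhs_right_gt.
case/(filterI d0)/filter_ex => d [d_gt0].
rewrite /L /energy_body /= energyZ -/E ExC; apply/negP.
rewrite -ltNge ltr_pMl // exprn_egt1 ?ltrDl // -lt0n.
exact: exp_gt0.
Qed.

(** On the region E > 0 Euler's identity makes the differential at y nonzero in the direction y. *)
Lemma defining_function_energy x : E x = C ->
  defining_function_at L x [set y | 0 < E y] (fun y => E y - C).
Proof.
move=> ExC; split.
- split; last by rewrite /= ExC.
  by apply: (@open_comp _ _ E [set y | 0 < y]) => [y _|]; [exact: E_cont|exact: open_gt].
- apply: (@polyfun_smooth _ _ (E - cst C)).
  rewrite (_ : E - cst C = E + cst (- C)) //.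
  by apply: polyfun_add; [exact: polyfun_energy|exact: polyfun_cst].
- move=> y Ey; exists y; rewrite diff_energy_shift // denergy_xx //.
  by rewrite mulf_neq0 ?pnatr_eq0 ?gt_eqF.
- apply/seteqP; split=> y [].
    by move=> /bdry_energy_body Ey Uy; split=> //=; rewrite Ey subrr.
  by move=> /= /subr0_eq Ey Uy; split=> //; exact/bdry_energy_body.
Qed.

Lemma energy_body_smooth : smooth_boundary L.
Proof.
move=> x /bdry_energy_body Ex.
by exists [set y | 0 < E y], (fun y => E y - C); exact: defining_function_energy.
Qed.

(* The characteristic direction at [x] is omega-orthogonal to the kernel of the
   differential of the energy, hence [omega xi] is proportional to it. *)
Lemma characteristic_energy_body x xi : bdry L x -> xi != 0 ->
  characteristic_line L x xi ->
  omega xi x != 0 /\ omega_polar L ((omega xi x)^-1 *: xi).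
Proof.
move=> /bdry_energy_body Ex xi0 [_ xiT].
pose D := denergy us (2 ^ j) x.
have Dx : 0 < D x by rewrite /D denergy_xx // mulr_gt0 ?ltr0n // -/E Ex.
have prop z : omega xi z = omega xi x * (D z / D x).
  have /(_ (z - (D z / D x) *: x)) := xiT; rewrite omegaBr omegaZr.
  move=> /(_ _)/subr0_eq ->; first by rewrite mulrC.
  exists [set y | 0 < E y], (fun y => E y - C).
  split; first exact: defining_function_energy.
  by rewrite diff_energy_shift // denergyB denergyZ divfK ?subrr // gt_eqF.
have xix : omega xi x != 0.
  apply: contra xi0 => /eqP xix; apply/eqP; apply: omega_nondegenerate => z.
  by rewrite prop xix mul0r.
(* It remains to see D z <= D x: the tangent inequality at x gives D (z - x) <= E z - E x <= 0. *)
split=> // z Lz; rewrite omegaZl (prop z) mulKf // ler_pdivrMr // mul1r -subr_le0.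
rewrite /D -denergyB; have := energy_tangent us j x z.
by rewrite -/E Ex; move: Lz; rewrite /L /energy_body /= -/E; lra.
Qed.
End Positive.
End EnergyBody.

(** * Monotonicity and differentiation along curves *)

Section ClosedCurves.
Variables (R : realType) (n : nat).
Implicit Types (g : R -> 'rV[R]_(n + n)) (f df H : R -> R).

Lemma ndecr_is_derive f df : (forall t : R, 0 <= t <= 1 -> is_derive t 1 f (df t)) ->
  (forall t : R, 0 <= t <= 1 -> 0 <= df t) ->
  forall x y : R, 0 <= x -> x <= y -> y <= 1 -> f x <= f y.
Proof.
move=> fdf df0; have itvW (t : R) : t \in `]0, 1[ -> 0 <= t <= 1.
  by rewrite in_itv /= => /andP[/ltW -> /ltW ->].
apply: ger0_derive1_ndecr => [t /itvW t01|t /itvW t01|].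
- by case: (fdf _ t01).
- by rewrite derive1E; case: (fdf _ t01) => _ ->; exact: df0.
- apply: derivable_within_continuous => t; rewrite in_itv /= => t01.
  by case: (fdf _ t01).
Qed.

Lemma is_derive_omega_comp g (t : R) dg v : is_derive t 1 g dg ->
  is_derive t 1 (fun t => omega v (g t)) (omega v dg).
Proof.
move=> gdg; rewrite /omega.
rewrite (_ : (fun t => _) = \sum_(i < n)
    (pcoord v i *: (fun t => g t ord0 (lshift n i)) -
     qcoord v i *: (fun t => g t ord0 (rshift n i)))); last first.
  by apply/funext => x; rewrite fct_sumE; apply: eq_bigr.
apply: is_derive_sum => i.
have := is_derive_entry ord0 (lshift n i) gdg.
have := is_derive_entry ord0 (rshift n i) gdg => dp dq.
exact: is_derive_eq.
Qed.

(** * Lower bound for the length of a closed curve with controlled velocities *)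

Section LengthBound.
Variables (g g' : R -> 'rV[R]_(n + n)) (La lam : R -> R) (sg s : R).
Hypothesis g_der : forall t : R, is_derive t 1 g (g' t).
Hypothesis La_der : forall t : R, 0 <= t <= 1 -> is_derive t 1 La (lam t).
Hypothesis sg1 : `|sg| = 1.
Hypothesis lamE : forall t, omega (g' t) (g t) = sg * lam t.
Hypothesis lam_gt0 : forall t, 0 < lam t.
Hypothesis lam_bound : forall t u, `|omega (g' t) (g' u)| <= s * lam t * lam u.
Hypothesis La0 : La 0 = 0.
Hypothesis g_closed : g 1 = g 0.

(** With t fixed, [lam_bound] makes s lam(t) La(u) - e omega (g' t) (g u) nondecreasing in u.
    Comparing u = t with u = 0 gives one bound, and with u = 1, where the curve closes up, the
    other. *)
Let bound01 (e t : R) : `|e| <= 1 -> 0 <= t <= 1 ->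
  e * (omega (g' t) (g t) - omega (g' t) (g 0)) <= s * lam t * La t /\
  e * (omega (g' t) (g 0) - omega (g' t) (g t)) <= s * lam t * (La 1 - La t).
Proof.
move=> e1 t01; have /andP[t0 t1] := t01.
pose phi := (s * lam t) *: La - e *: (fun u => omega (g' t) (g u)).
have mono x y : 0 <= x -> x <= y -> y <= 1 -> phi x <= phi y.
  apply: (@ndecr_is_derive phi
    (fun u => (s * lam t) *: lam u - e *: omega (g' t) (g' u))) => u u01.
    have := La_der u01; have := is_derive_omega_comp (g' t) (g_der u) => d1 d2.
    exact: is_derive_eq.
  rewrite subr_ge0; apply: le_trans (lam_bound t u); apply: le_trans (ler_norm _) _.
  by rewrite normrM ler_piMl.
have := mono _ _ (lexx 0) t0 t1; have := mono _ _ t0 t1 (lexx 1).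
rewrite /phi !fctE La0 g_closed /GRing.scale /=; split; lra.
Qed.

(* [sg * omega (g' t) (g t - g 0)] is bounded by [s lam La] and by
   [s lam (La 1 - La)]; it has the explicit primitive [La + sg * omega (g 0) (g t)],
   whose boundary terms at the midpoint [tm] of the length cancel when the bounds
   on [[0, tm]] and [[tm, 1]] are added. *)
Lemma length_bound : 4 <= s * La 1.
Proof.
have sg2 : sg * sg = 1 by rewrite -expr2 -real_normK ?num_real // sg1 expr1n.
have La_mono := ndecr_is_derive La_der (fun t _ => ltW (lam_gt0 t)).
have La1_ge0 : 0 <= La 1 by rewrite -La0; exact: La_mono.
have Lac : {within `[0, 1], continuous La}.
  apply: derivable_within_continuous => t; rewrite in_itv /= => t01.
  by case: (La_der t01).
have La1 : 0 < La 1.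
  have La_oo (t : R) : t \in `]0, 1[ -> is_derive t 1 La (lam t).
    by rewrite in_itv /= => /andP[t0 t1]; apply: La_der; rewrite !ltW.
  have [c _] := MVT ltr01 La_oo Lac.
  by rewrite La0 !subr0 mulr1 => ->.
have [tm] : exists2 c, c \in `[0, 1] & La c = La 1 / 2.
  apply: IVT => //; rewrite La0 min_l // max_r //; lra.
rewrite in_itv /= => /andP[tm0 tm1] Latm.
have dQ (t : R) : 0 <= t <= 1 -> is_derive t 1
    ((s / 2) *: (La * La) - La - sg *: (fun t => omega (g 0) (g t)))
    (s * La t * lam t - sg * (omega (g' t) (g t) - omega (g' t) (g 0))).
  move=> t01; have := La_der t01; have := is_derive_omega_comp (g 0) (g_der t) => d1 d2.
  apply: is_derive_eq; rewrite /GRing.scale /= lamE (omegaC (g 0)).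
  have : sg * (sg * lam t) = lam t by rewrite mulrA sg2 mul1r.
  by move: (omega _ _) => w; lra.
have dQ2 (t : R) : 0 <= t <= 1 -> is_derive t 1
    (- ((s / 2) *: ((cst (La 1) - La) * (cst (La 1) - La))) - La
      - sg *: (fun t => omega (g 0) (g t)))
    (s * (La 1 - La t) * lam t - sg * (omega (g' t) (g t) - omega (g' t) (g 0))).
  move=> t01; have := La_der t01; have := is_derive_omega_comp (g 0) (g_der t) => d1 d2.
  apply: is_derive_eq; rewrite /GRing.scale /= lamE (omegaC (g 0)) !fctE.
  have : sg * (sg * lam t) = lam t by rewrite mulrA sg2 mul1r.
  by move: (omega _ _) => w; lra.
pose w t := omega (g 0) (g t).
have Q01 : s / 2 * (La 0 * La 0) - La 0 - sg * w 0 <=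
    s / 2 * (La tm * La tm) - La tm - sg * w tm.
  apply: (ndecr_is_derive dQ) => // t t01.
  by have [] := @bound01 sg t ltac:(by rewrite sg1) t01; lra.
have Q12 : - (s / 2 * ((La 1 - La tm) * (La 1 - La tm))) - La tm - sg * w tm <=
    - (s / 2 * ((La 1 - La 1) * (La 1 - La 1))) - La 1 - sg * w 1.
  apply: (ndecr_is_derive dQ2) => // t t01.
  by have [] := @bound01 (- sg) t ltac:(by rewrite normrN sg1) t01; lra.
have w0 : w 0 = 0 by exact: omega_xx.
have w1 : w 1 = 0 by rewrite /w g_closed omega_xx.
rewrite La0 w0 Latm in Q01; rewrite w1 Latm in Q12.
(* Each half contributes s (La 1)^2 / 8, so the sum reads La 1 <= s (La 1)^2 / 4. *)
have : 0 <= La 1 * (s * La 1 - 4) by lra.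
by rewrite pmulr_rge0 // subr_ge0.
Qed.
End LengthBound.
End ClosedCurves.

(** * From length to action *)

Section ActionBound.
Variables (R : realType) (n : nat).
Implicit Types (g : R -> 'rV[R]_(n + n)) (f : R -> R).

Lemma continuous_same_sign f a b : continuous f -> (forall t, f t != 0) ->
  a <= b -> 0 < f a * f b.
Proof.
move=> fc f0 ab; rewrite ltNge; apply/negP => fab.
have [c _ fc0] : exists2 c, c \in `[a, b] & f c = 0.
  apply: IVT => //; first exact: continuous_subspaceT.
  by have [fle|flt] := leP (f a) (f b); apply/andP; split; nra.
by have := f0 c; rewrite fc0 eqxx.
Qed.

(** The intermediate value theorem forces a constant sign. This lets a primitive of the absolute
    value be read off from a primitive of f. *)
Lemma continuous_sg f t : continuous f -> (forall t, f t != 0) ->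
  `|f t| = Num.sg (f 0) * f t.
Proof.
move=> fc f0; have h : 0 < f 0 * f t.
  have [t0|t0] := leP 0 t; first exact: continuous_same_sign.
  by rewrite mulrC; apply: continuous_same_sign => //; exact: ltW.
have [p|p|p] := ltgtP 0 (f 0); last by move: (f0 0); rewrite -p eqxx.
  by rewrite (gtr0_sg p) mul1r gtr0_norm // -(pmulr_rgt0 _ p).
by rewrite (ltr0_sg p) mulN1r ltr0_norm // -(nmulr_rgt0 _ p).
Qed.

Lemma primitive_itv01 f : continuous f -> exists F : R -> R,
  (forall t : R, 0 <= t <= 1 -> is_derive t 1 F (f t)) /\
  F 1 - F 0 = \int[lebesgue_measure]_(t in `[0, 1]) f t.
Proof.
move=> fc.
have int_f (a b : R) : (@lebesgue_measure R).-integrable `[a, b] (EFin \o f).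
  apply: continuous_compact_integrable; first exact: segment_compact.
  exact: continuous_subspaceT.
(* Starting the integral at -1 makes 0 an interior point, so the derivative is two-sided on all of
   [0, 1]. *)
exists (fun x => \int[lebesgue_measure]_(t in `[-1, x]) f t); split.
  move=> t /andP[t0 t1].
  have t2 : t < 2 by lra.
  have Nt : -1 < t by lra.
  have [dF F't] := continuous_FTC1_closed t2 (int_f _ _) Nt (fc t).
  by apply: DeriveDef; [exact: dF|rewrite -derive1E; exact: F't].
have N0 : (BLeft (-1 : R) <= BRight 0)%O by rewrite bnd_simp; lra.
have N1 : (BRight (0 : R) <= BRight 1)%O by rewrite bnd_simp; lra.
rewrite (Rintegral_itvB (int_f _ _) N0 N1) Rintegral_itv_obnd_cbnd //.
apply: integrableS (int_f 0 1) => //.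
by apply: subset_itvr; rewrite bnd_simp.
Qed.

(** Since omega g g' = 2 sum p q' - (sum p q)', a primitive is twice that of p dq minus sum p q, and
    the latter has equal values at both ends of the loop. *)
Lemma action_primitive g g' : (forall t : R, is_derive t 1 g (g' t)) ->
  continuous g' -> g 1 = g 0 -> exists H : R -> R,
  (forall t : R, 0 <= t <= 1 -> is_derive t 1 H (omega (g t) (g' t))) /\
  H 1 - H 0 = 2 * action g.
Proof.
move=> gd g'c g10.
have gc : continuous g.
  move=> t; apply: differentiable_continuous; apply/derivable1_diffP.
  by case: (gd t).
have g'E : derive1 g = g' by apply/funext => t; rewrite derive1E; case: (gd t).
pose f (t : R) := \sum_(i < n) pcoord (g t) i * qcoord (g' t) i.
have fc : continuous f.
  apply: (@continuous_big R _ +%R 0 xpredT) => [|i _].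
    exact: add_continuous.
  move=> t; apply: (@continuousM _ _ (fun t => pcoord (g t) i)
    (fun t => qcoord (g' t) i)).
    apply: (@continuous_comp _ _ _ g (fun x => pcoord x i)); first exact: gc.
    exact: coord_continuous.
  apply: (@continuous_comp _ _ _ g' (fun x => qcoord x i)); first exact: g'c.
  exact: coord_continuous.
have [F [Fd F10]] := primitive_itv01 fc.
pose q i (t : R) := g t ord0 (lshift n i); pose p i (t : R) := g t ord0 (rshift n i).
pose S := \sum_(i < n) p i * q i.
have S10 : S 1 = S 0.
  by rewrite /S !fct_sumE; apply: eq_bigr => i _; rewrite !fctE /p /q g10.
exists (2 *: F - S); split; last first.
  have -> : (2 *: F - S) 1 - (2 *: F - S) 0 = 2 * F 1 - S 1 - (2 * F 0 - S 0) by [].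
  rewrite S10 /action g'E -/f -F10; ring.
move=> t t01; have := Fd t t01 => dF.
have dp i := is_derive_entry ord0 (rshift n i) (gd t).
have dq i := is_derive_entry ord0 (lshift n i) (gd t).
apply: is_derive_eq.
rewrite /f /omega [_ *: _]big_distrr -sumrB; apply: eq_bigr => i _.
by rewrite /GRing.scale /= /p /q /pcoord /qcoord; ring.
Qed.

Lemma action_lower_bound g g' s : (forall t : R, is_derive t 1 g (g' t)) ->
  continuous g' -> g 1 = g 0 ->
  (forall t, omega (g' t) (g t) != 0) ->
  (forall t u, omega ((omega (g' t) (g t))^-1 *: g' t)
                     ((omega (g' u) (g u))^-1 *: g' u) <= s) ->
  2 <= s * `|action g|.
Proof.
move=> gd g'c g10 lam0 bound.
pose lam t := omega (g' t) (g t).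
have lamc : continuous lam.
  have gc : continuous g.
    move=> t; apply: differentiable_continuous; apply/derivable1_diffP.
    by case: (gd t).
  apply: (@continuous_big R _ +%R 0 xpredT) => [|i _]; first exact: add_continuous.
  have c (h : R -> 'rV[R]_(n + n)) k : continuous h -> continuous (fun t => h t ord0 k).
    move=> hc t; apply: (@continuous_comp _ _ _ h (fun x => x ord0 k)).
      exact: hc.
    exact: coord_continuous.
  move=> t; apply: (@continuousB _ _ _ (fun t => pcoord (g' t) i * qcoord (g t) i)
    (fun t => qcoord (g' t) i * pcoord (g t) i)); apply: continuousM; exact: c.
have lamE := continuous_sg _ lamc lam0.
pose sg := Num.sg (lam 0).
have sg1 : `|sg| = 1 by rewrite normr_sg lam0.
have sg2 : sg * sg = 1 by rewrite -expr2 -real_normK ?num_real // sg1 expr1n.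
have [H [Hd H10]] := action_primitive gd g'c g10.
(* H is a primitive of omega g g' = - [lam]; the factor - [sg] turns its derivative into the
   absolute value of [lam]. *)
pose La t := - sg * (H t - H 0).
have La_der (t : R) : 0 <= t <= 1 -> is_derive t 1 La `|lam t|.
  move=> t01; have := Hd t t01 => dH.
  have -> : La = (- sg) *: (H - cst (H 0)) by [].
  apply: is_derive_eq; rewrite lamE subr0 -/sg (omegaC (g t)).
  by rewrite /GRing.scale /= mulrNN.
have h : 4 <= s * La 1.
  apply: (@length_bound _ _ g g' La (fun t => `|lam t|) sg s gd La_der sg1) => //.
  - by move=> t; rewrite lamE -/sg mulrA sg2 mul1r.
  - by move=> t; rewrite normr_gt0; exact: lam0.
  - move=> t u.
    have uE x : g' x = lam x *: ((lam x)^-1 *: g' x).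
      by rewrite scalerA divff ?scale1r //; exact: lam0.
    (* The one-sided bound holds for both orders of t and u, so antisymmetry makes it two-sided. *)
    have W : `|omega ((lam t)^-1 *: g' t) ((lam u)^-1 *: g' u)| <= s.
      by rewrite ler_norml bound andbT lerNl -omegaC bound.
    rewrite (uE t) (uE u) omegaZl omegaZr !normrM.
    have := ler_wpM2l (mulr_ge0 (normr_ge0 (lam t)) (normr_ge0 (lam u))) W; lra.
  - by rewrite /La subrr mulr0.
have La1 : `|La 1| = 2 * `|action g|.
  by rewrite /La H10 normrM normrN sg1 mul1r normrM ger0_norm.
have s0 : 0 <= s.
  by apply: le_trans (bound 0 0); rewrite omega_xx.
have := ler_wpM2l s0 (ler_norm (La 1)); rewrite La1; lra.
Qed.
End ActionBound.

(** * Approximation of symmetric convex bodies by smooth ones *)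

Section PolarApproximation.
Variables (R : realType) (n : nat).
Implicit Types (K : set 'rV[R]_(n + n)) (x y z u v : 'rV[R]_(n + n)).

Lemma convex_combination K x y (t : R) : convex_set K -> K x -> K y ->
  0 <= t -> t <= 1 -> K (t *: x + (1 - t) *: y).
Proof.
move=> Kconv Kx Ky t0 t1.
by have := Kconv x y (Itv01 t0 t1); rewrite !inE; exact.
Qed.

Lemma centrally_symmetric_origin K : convex_set K -> K !=set0 ->
  centrally_symmetric K -> K 0.
Proof.
move=> Kconv [x Kx] Ksym.
have KNx : K (- x) by rewrite Ksym; exists x.
have := @convex_combination K x (- x) 2^-1 Kconv Kx KNx ltac:(lra) ltac:(lra).
by rewrite scalerN -scalerBl (_ : 2^-1 - _ = 0) ?scale0r //; lra.
Qed.

Lemma edot_sub_scale y z (t : R) :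
  edot (y - t *: z) (y - t *: z) =
  edot y y - 2 * t * edot y z + t ^+ 2 * edot z z.
Proof.
rewrite /edot !big_distrr -sumrB -big_split; apply: eq_bigr => i _ /=.
by rewrite !mxE; ring.
Qed.

Lemma edot_ge0 y : 0 <= edot y y.
Proof. by apply: sumr_ge0 => i _; rewrite -expr2 sqr_ge0. Qed.

Lemma edot_gt0 y : y != 0 -> 0 < edot y y.
Proof.
move=> y0; rewrite lt_neqAle edot_ge0 andbT eq_sym; apply: contra y0 => yy.
apply/eqP/rowP => i; rewrite mxE; apply/eqP; rewrite -sqrf_eq0 expr2.
move: yy; rewrite psumr_eq0 => [|j _]; last by rewrite -expr2 sqr_ge0.
by move=> /allP /(_ i (mem_index_enum _)).
Qed.

(* The separating functional is normal to [K] at the nearest point to [x]. *)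
Lemma omega_polar_separation K x : compact K -> convex_set K -> K 0 -> ~ K x ->
  exists2 u, omega_polar K u & 1 < omega u x.
Proof.
move=> Kc Kconv K0 nKx.
have fpoly : polynomial_function (fun k : 'rV[R]_(n + n) => edot (x - k) (x - k)).
  apply: polyfun_sum => i.
  have pi : polynomial_function (fun k : 'rV[R]_(n + n) => (x - k) ord0 i).
    rewrite (_ : (fun k : 'rV[R]_(n + n) => _) =
        cst (x ord0 i) + (fun k : 'rV[R]_(n + n) => -1 * k ord0 i)).
      apply: polyfun_add; first exact: polyfun_cst.
      by apply: polyfun_scale; exact: polyfun_coord.
    by apply/funext => k; rewrite !mxE; congr (_ + _); exact/esym/mulN1r.
  exact: (polyfun_mul pi pi).
have [c] : exists2 c, c \in K & forall k, k \in K ->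
    edot (x - c) (x - c) <= edot (x - k) (x - k).
  apply: EVT_min_rV => //; first by exists 0.
  exact/continuous_subspaceT/polyfun_continuous.
rewrite inE => Kc' cmin; pose y := x - c.
have y0 : y != 0 by rewrite subr_eq0; apply: contra_not_neq nKx => ->.
have yy := edot_gt0 y0.
have ny k : K k -> edot y (k - c) <= 0.
  move=> Kk; rewrite leNgt; apply/negP => a0.
  set a := edot y (k - c) in a0; pose b := edot (k - c) (k - c).
  have b0 : 0 <= b by exact: edot_ge0.
  (* This t lies in (0, 1] for every b >= 0 and satisfies t b < 2 a, so moving from c towards k
     would strictly decrease the distance to x. *)
  pose t := a / (a + b).
  have t0 : 0 < t by rewrite divr_gt0 // ltr_wpDr.
  have t1 : t <= 1 by rewrite ler_pdivrMr ?ltr_wpDr // mul1r lerDl.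
  have := cmin (t *: k + (1 - t) *: c).
  rewrite inE => /(_ (convex_combination Kconv Kk Kc' (ltW t0) t1)).
  rewrite (_ : x - (_ + _) = y - t *: (k - c)); last first.
    by rewrite /y; apply/rowP => i; rewrite !mxE; ring.
  rewrite edot_sub_scale -/y -/a -/b => h.
  have : t * (a + b) = a by rewrite /t divfK // gt_eqF // ltr_wpDr.
  nra.
have yomega z w : edot y (z - w) = omega (jmul y) z - omega (jmul y) w.
  by rewrite -omega_jmul omegaBr.
have h0 := ny _ K0; rewrite yomega in h0.
have hx : omega (jmul y) x - omega (jmul y) c = edot y y by rewrite -yomega.
have z0 : omega (jmul y) 0 = 0 by rewrite omegaC omega0l oppr0.
(* A level strictly between the maximum over K, attained at c, and the value at x. It is positive
   because 0 in K makes the value at c nonnegative. *)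
pose M := (omega (jmul y) c + omega (jmul y) x) / 2.
have M0 : 0 < M by rewrite /M; lra.
exists (M^-1 *: jmul y) => [k Kk|]; rewrite omegaZl mulrC.
  rewrite ler_pdivrMr // mul1r; have := ny _ Kk; rewrite yomega /M; lra.
by rewrite ltr_pdivlMr // mul1r /M; lra.
Qed.

Lemma compact_norm_bound K : compact K -> exists2 B : R, 0 <= B &
  forall k, K k -> `|k| <= B.
Proof.
move=> /compact_bounded [B [_ KB]].
exists (Num.max 0 (B + 1)) => [|k Kk]; first by rewrite le_max lexx.
by rewrite le_max (KB (B + 1)) ?orbT // ltrDl.
Qed.

(** The points of norm at most B + d at distance at least d from K form a compact set; by separation
    the half-spaces omega u > 1 with u in the polar cover it, and a finite subcover gives the
    list. *)
Lemma polytope_approximation K (d : R) : compact K -> convex_set K -> K 0 ->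
  0 < d -> exists us : seq 'rV[R]_(n + n),
    (forall u, u \in us -> omega_polar K u) /\
    (forall x, (forall u, u \in us -> omega u x <= 1) ->
      exists2 k, K k & `|x - k| < d).
Proof.
move=> Kc Kconv K0 d0; have [B B0 KB] := compact_norm_bound Kc.
pose far k : set 'rV[R]_(n + n) := [set x | d <= `|x - k|].
pose S := [set x : 'rV[R]_(n + n) | `|x| <= B + d] `&` \bigcap_(k in K) far k.
have : compact S.
  apply: bounded_closed_compact.
    exists (B + d); split=> [|r Br x [xB _]]; first exact: num_real.
    exact: le_trans xB (ltW Br).
  apply: closedI.
    apply: (@closed_comp _ _ (fun x : 'rV[R]_(n + n) => `|x|) [set r | r <= B + d]).
      by move=> x _; exact: norm_continuous.
    exact: closed_le.
  apply: closed_bigI => k _.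
  apply: (@closed_comp _ _ (fun x : 'rV[R]_(n + n) => `|x - k|) [set r | d <= r]).
    move=> x _; apply: (@continuous_comp _ _ _ (fun x => x - k) (fun y => `|y|)).
      by apply: continuousB; [exact: cvg_id|exact: cst_continuous].
    exact: norm_continuous.
  exact: closed_ge.
rewrite compact_cover => Sc.
have open_gt1 u : omega_polar K u -> open [set x | 1 < omega u x].
  move=> _; apply: (@open_comp _ _ (omega u) [set r | 1 < r]) => [x _|].
    exact: omega_continuous.
  exact: open_gt.
have S_cover : S `<=` cover (omega_polar K) (fun u => [set x | 1 < omega u x]).
  move=> x [_ Sx]; have nKx : ~ K x.
    by move=> Kx; have := Sx _ Kx; rewrite /far /= subrr normr0; lra.
  by have [u Ku ux] := omega_polar_separation Kc Kconv K0 nKx; exists u.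
have [us usK Scov] := Sc _ _ _ open_gt1 S_cover.
exists (finmap.enum_fset us); split=> [u /usK|x usx]; first by rewrite inE.
have SP y : (forall u, u \in finmap.enum_fset us -> omega u y <= 1) -> ~ S y.
  by move=> usy /Scov[u /= /usy]; rewrite leNgt => /negP.
apply: contrapT => noK.
have xfar k : K k -> d <= `|x - k|.
  by move=> Kk; rewrite leNgt; apply/negP => xk; apply: noK; exists k.
have [xB|xB] := leP `|x| (B + d); first by apply: (SP x).
have r0 : 0 < B + d by lra.
(* A point of larger norm is shrunk to norm B + d: it still satisfies all the inequalities and is
   still at distance at least d from K, so it would lie in S. *)
pose t := (B + d) / `|x|.
have t0 : 0 < t by rewrite divr_gt0 // (lt_trans r0).
have t1 : t <= 1 by rewrite ler_pdivrMr ?(lt_trans r0) // mul1r ltW.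
have tx : `|t *: x| = B + d.
  by rewrite normrZ gtr0_norm // divfK // gt_eqF // (lt_trans r0).
apply: (SP (t *: x)) => [u /usx ux|].
  by rewrite omegaZr; nra.
split=> [|k Kk]; rewrite /far /= ?tx //.
have := lerB_dist (t *: x) k; rewrite tx; have := KB _ Kk; lra.
Qed.

Lemma energy_body_approximation K (eta : R) : compact K -> convex_set K -> K 0 ->
  centrally_symmetric K -> 0 < eta ->
  exists us j (C : R), [/\ 0 < C, K `<=` energy_body us j C &
    forall x, energy_body us j C x -> exists2 k, K k & `|x - k| <= eta].
Proof.
move=> Kc Kconv K0 Ksym eta0; have [B B0 KB] := compact_norm_bound Kc.
have [|us [usK us_near]] := @polytope_approximation K (Num.min 1 (eta / 2)) Kc Kconv K0.
  by rewrite lt_min ltr01 divr_gt0.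
(* Undoing the rescaling by 1 + e moves a point of norm at most B + 1 by at most eta / 2. *)
pose e := eta / 2 / (B + 1).
have e0 : 0 < e by rewrite !divr_gt0 //; lra.
(* On K each summand is at most 1; the successor keeps C positive for an empty list. *)
pose C : R := (size us).+1%:R.
(* Then 2^j e >= C, hence (1 + e)^(2^j) >= C by Bernoulli, and no functional of the list exceeds 1 +
   e on the body. *)
pose j := (Num.truncn (C / e)).+1.
have pow_even (a : R) : 0 <= a ^+ (2 ^ j).
  by apply: exprn_even_ge0; rewrite oddX.
have powC : C <= (1 + e) ^+ (2 ^ j).
  have := expr2n_tangent 1 (1 + e) j; rewrite !expr1n mulr1 [1 + e]addrC addrK.
  apply: le_trans; apply: (@le_trans _ _ ((2 ^ j)%:R * e)); last by rewrite lerDr.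
  rewrite -ler_pdivrMr //; apply: ltW; apply: lt_trans (truncnS_gt _) _.
  by rewrite ltr_nat ltn_expl.
exists us, j, C; split; first by rewrite ltr0n.
- move=> x Kx; rewrite /energy_body /energy /=.
  apply: (@le_trans _ _ (\sum_(u <- us) 1)); last first.
    by rewrite big_const_seq count_predT iter_addr_0 ler_nat.
  rewrite big_seq [leRHS]big_seq; apply: ler_sum => u /usK Ku.
  rewrite -[1](expr1n _ (2 ^ j)) -[leLHS]ger0_norm ?pow_even // normrX.
  apply: lerXn2r; rewrite ?nnegrE // ler_norml Ku // andbT lerNl -omegaNr Ku //.
  by move: Kx; rewrite Ksym => -[y Ky <-]; rewrite opprK -Ksym.
move=> x Lx.
have ule u : u \in us -> omega u x <= 1 + e.
  move=> uus; rewrite leNgt; apply/negP => ux.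
  have : (1 + e) ^+ (2 ^ j) < omega u x ^+ (2 ^ j).
    by rewrite ltrXn2r -?lt0n ?expn_gt0 //; lra.
  rewrite ltNge => /negP; apply; apply: le_trans powC.
  apply: le_trans Lx; rewrite /energy (big_rem u) //= lerDl.
  by apply: sumr_ge0 => v _.
have [k Kk xk] : exists2 k, K k & `|(1 + e)^-1 *: x - k| < Num.min 1 (eta / 2).
  apply: us_near => u /ule ux.
  by rewrite omegaZr ler_pdivrMl ?mulr1 //; lra.
exists k => //; move: xk; rewrite lt_min => /andP[xk1 xk2].
set z := (1 + e)^-1 *: x in xk1 xk2.
have xE : x = z + e *: z.
  by rewrite -[X in X + _]scale1r -scalerDl /z scalerA divff ?scale1r // gt_eqF //; lra.
have zB : `|z| <= B + 1.
  have := ler_normD (z - k) k; rewrite subrK; have := KB _ Kk; lra.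
have eE : e * (B + 1) = eta / 2 by rewrite /e divfK // gt_eqF //; lra.
rewrite xE addrAC; apply: le_trans (ler_normD _ _) _; rewrite normrZ gtr0_norm //.
have := ler_wpM2l (ltW e0) zB; lra.
Qed.

Lemma enorm_le_norm (m : nat) (x : 'rV[R]_m) : enorm x <= m%:R * `|x|.
Proof.
have coord i : `|x ord0 i| <= `|x|.
  rewrite [leRHS]/Num.Def.normr /= mx_normrE.
  by apply: le_trans (le_bigmax _ _ (ord0, i)).
have mx0 : 0 <= m%:R * `|x| by rewrite mulr_ge0.
rewrite /enorm -[leRHS]ger0_norm // -sqrtr_sqr ler_wsqrtr //.
apply: (@le_trans _ _ (\sum_(i < m) `|x| ^+ 2)).
  by apply: ler_sum => i _; rewrite -real_normK ?num_real // lerXn2r ?nnegrE.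
rewrite sumr_const card_ord exprMn -[leLHS]mulr_natl ler_wpM2r ?sqr_ge0 //.
by case: m {x coord mx0} => [|m]; rewrite -natrX ler_nat //; exact: leq_pmulr.
Qed.

Lemma hausdorff_dist_le (m : nat) (K L : set 'rV[R]_m) (e : R) :
  K !=set0 -> K `<=` L ->
  (forall x : 'rV[R]_m, L x -> exists2 k, K k & enorm (x - k) <= e) ->
  0 <= e -> hausdorff_dist K L <= e.
Proof.
move=> [k0 Kk0] KL LK e0.
have enorm_ge0 (x : 'rV[R]_m) : 0 <= enorm x by exact: sqrtr_ge0.
have inf_le (x : 'rV[R]_m) (A : set 'rV[R]_m) a : A a -> edist_set x A <= enorm (x - a).
  by move=> Aa; apply: ge_inf; [exists 0 => _ [b _ <-]|exists a].
rewrite ge_max; apply/andP; split; apply: ge_sup.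
- by exists (edist_set k0 L), k0.
- move=> _ [k Kk <-]; apply: le_trans e0; apply: le_trans (inf_le _ _ _ (KL _ Kk)) _.
  by rewrite subrr /enorm big1 ?sqrtr0 // => i _; rewrite mxE expr0n.
- by exists (edist_set k0 K), k0 => //; exact: KL.
- move=> _ [x /LK[k Kk xk] <-]; exact: le_trans (inf_le _ _ _ Kk) xk.
Qed.

End PolarApproximation.

(** * Lower bound for the Ekeland-Hofer-Zehnder capacity *)

Section Capacity.
Variables (R : realType) (n : nat).

Lemma energy_body_convex_body (us : seq 'rV[R]_(n + n)) j (C eta : R) K :
  convex_body K -> K `<=` energy_body us j C ->
  (forall x, energy_body us j C x -> exists2 k, K k & `|x - k| <= eta) ->
  convex_body (energy_body us j C).
Proof.
move=> [Kc _ [x0 Kx0]] KL LK; split.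
- have [B _ KB] := compact_norm_bound Kc.
  apply: bounded_closed_compact; last exact: energy_body_closed.
  exists (eta + B); split=> [|r Br x /LK[k Kk xk]]; first exact: num_real.
  have := ler_normD (x - k) k; rewrite subrK; have := KB _ Kk => /=; lra.
- exact: energy_body_convex.
- by exists x0; apply: interiorS KL _ Kx0.
Qed.

(** Polarity reverses inclusions, so the normalized velocities, which lie in the polar of the larger
    body, satisfy the bound assumed on the polar of K. *)
Lemma closed_characteristic_action us j (C s : R) K
    (gamma : R -> 'rV[R]_(n + n)) :
  0 < C -> K `<=` energy_body us j C ->
  (forall u v, omega_polar K u -> omega_polar K v -> omega u v <= s) ->
  closed_characteristic (energy_body us j C) gamma -> 2 <= s * `|action gamma|.
Proof.
move=> C0 KL bound [gs gper _ g0 gchar].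
have gder (t : R) : is_derive t 1 gamma (derive1 gamma t).
  apply: DeriveDef; last by rewrite derive1E.
  by apply: diff_derivable; exact: (gs [::]).
have gcont : continuous (derive1 gamma).
  move=> t; rewrite (_ : derive1 gamma = 'D_1 gamma); last first.
    by apply/funext => x; rewrite derive1E.
  by apply: differentiable_continuous; exact: (gs [:: 1]).
have g10 : gamma 1 = gamma 0 by rewrite -[1]add0r gper.
have char t : omega (derive1 gamma t) (gamma t) != 0 /\
    omega_polar K ((omega (derive1 gamma t) (gamma t))^-1 *: derive1 gamma t).
  have [bd ch] := gchar t.
  have [l0 pol] := characteristic_energy_body C0 bd (g0 t) ch.
  by split=> // z /KL; exact: pol.
apply: (action_lower_bound gder gcont g10) => [t|t u]; first by case: (char t).
by apply: bound; [case: (char t)|case: (char u)].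
Qed.

(** A close smooth body containing K has capacity below c K + e, and this capacity is the action of
    one of its closed characteristics. *)
Lemma ehz_capacity_lower_bound (c : set 'rV[R]_(n + n) -> R) K (e : R) :
  is_ehz_capacity c -> convex_body K -> centrally_symmetric K -> 0 < e ->
  0 <= c K + e /\
  forall s, 0 <= s ->
    (forall u v, omega_polar K u -> omega_polar K v -> omega u v <= s) ->
    2 <= s * (c K + e).
Proof.
move=> [c_smooth c_cont] Kbody Ksym e0.
have [Kc Kconv [x0 /interior_subset Kx0]] := Kbody.
have K0 : K 0 by apply: centrally_symmetric_origin => //; exists x0.
have [d d0 cd] := c_cont K Kbody e e0.
(* The factor m converts the max norm of the approximation into the Euclidean norm of the Hausdorff
   distance; the successor makes it positive. *)
pose m : R := (n + n).+1%:R.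
have m0 : 0 < m by rewrite ltr0n.
pose eta := d / 2 / m.
have eta0 : 0 < eta by rewrite !divr_gt0.
have [us [j [C [C0 KL LK]]]] := energy_body_approximation Kc Kconv K0 Ksym eta0.
have Lbody := energy_body_convex_body Kbody KL LK.
have KLd : hausdorff_dist K (energy_body us j C) < d.
  apply: (@le_lt_trans _ _ (d / 2)); last by lra.
  apply: hausdorff_dist_le => // [|x /LK[k Kk xk]|]; [by exists 0| |by lra].
  exists k => //; apply: le_trans (enorm_le_norm _) _.
  have -> : d / 2 = m * eta by rewrite /eta [RHS]mulrC divfK // gt_eqF.
  by apply: ler_pM => //; rewrite /m ler_nat.
have := cd _ Lbody KLd; rewrite ltr_norml => /andP[cL _].
have [[gamma gchar gE] _] := c_smooth _ Lbody (energy_body_smooth C0).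
have cL_le : `|action gamma| <= c K + e by rewrite gE; lra.
split=> [|s s0 bound]; first exact: le_trans cL_le.
apply: le_trans (closed_characteristic_action C0 KL bound gchar) _.
exact: ler_wpM2l.
Qed.

End Capacity.

(** * Comparison of the two bounds at a pair of polar vectors *)

Theorem theorem1p4 (R : realType) (n : nat) (n_ge1 : (1 <= n)%N)
  (cEHZ : set 'rV[R]_(n + n) -> R) (cEHZP : is_ehz_capacity cEHZ)
  (K : set 'rV[R]_(n + n)) (Kbody : convex_body K)
  (Ksym : centrally_symmetric K) :
  (cyl_capacity K <= (4 * cEHZ K)%:E)%E.
Proof.
apply/lee_addgt0Pr => e e0; pose a := cEHZ K + e / 4.
have e8 : 0 < e / 8 by rewrite divr_gt0.
have e4 : 0 < e / 4 by rewrite divr_gt0.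
(* Nonnegativity with the smaller margin e / 8 makes [a] strictly positive. *)
have [a8 _] := ehz_capacity_lower_bound cEHZP Kbody Ksym e8.
have [_ lower] := ehz_capacity_lower_bound cEHZP Kbody Ksym e4.
have a0 : 0 < a by rewrite /a; lra.
(* Chosen so that 2 pi / s = 4 a = 4 c(K) + e. As s a = pi / 2 < 2, the lower bound excludes omega
   <= s on the whole polar. *)
pose s := pi / 2 / a.
have s0 : 0 < s by rewrite !divr_gt0 ?pi_gt0.
have [u [v [Ku Kv uv]]] : exists u v,
    [/\ omega_polar K u, omega_polar K v & s < omega u v].
  apply: contrapT => no; have := lower s (ltW s0).
  rewrite -/a divfK ?gt_eqF // leNgt pihalf_lt2 => /(_ _)/negP; apply=> //.
  move=> u v Ku Kv; rewrite leNgt; apply/negP => uv.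
  by apply: no; exists u, v.
have w0 := lt_trans s0 uv.
apply: le_trans (cyl_capacity_le n_ge1 Ksym Ku Kv w0 erefl) _.
rewrite -EFinD lee_fin ler_pdivrMr //.
have -> : 4 * cEHZ K + e = 4 * a by rewrite /a; field.
have -> : 2 * pi = 4 * a * s :> R.
  rewrite -mulrA [a * s]mulrC divfK ?gt_eqF //.
  by move: (pi : R) => p; field.
by rewrite ler_wpM2l ?ltW // mulr_gt0.
Qed.
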